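(* Let $T$, $\Phi$, $\Psi$ and the homomorphism $\vartheta:\boxtimes_q\to\mathrm{Mat}_X(\mathbb C)$ be as in the context. Then (i) the image $\vartheta(\boxtimes_q)$ is contained in $T$; (ii) $T$ is generated by $\vartheta(\boxtimes_q)$ together with $\Phi$ and $\Psi$.
   Context: The $q$-tetrahedron algebra: for nonzero $q$ with $q^2\ne1$, $[n]_q=(q^n-q^{-n})/(q-q^{-1})$; $\boxtimes_q$ is the unital associative $\mathbb C$-algebra with generators $x_{ij}$, $i,j\in\mathbb Z_4$, $j-i\in\{1,2\}$, subject to: $x_{ij}x_{ji}=1$ if $j-i=2$; $\frac{qx_{hi}x_{ij}-q^{-1}x_{ij}x_{hi}}{q-q^{-1}}=1$ if $(i-h,j-i)\in\{(1,1),(1,2),(2,1)\}$; $x_{hi}^3x_{jk}-[3]_qx_{hi}^2x_{jk}x_{hi}+[3]_qx_{hi}x_{jk}x_{hi}^2-x_{jk}x_{hi}^3=0$ if $i-h=j-i=k-j=1$. The graph: $\Gamma=(X,R)$ is a finite, undirected, connected graph without loops or multiple edges, with path-length distance $\partial$, diameter $D\ge3$, distance-regular with intersection numbers $p^h_{ij}=|\{w:\partial(y,w)=i,\partial(w,z)=j\}|$ ($\partial(y,z)=h$), $c_i=p^i_{1,i-1}$, $b_i=p^i_{1,i+1}$, and there are $b,\beta\in\mathbb C$, $b\ne1$, with $c_i=b^{i-1}\frac{b^i-1}{b-1}$, $b_i=(\beta+1-b^i)\frac{b^D-b^i}{b-1}$ ($0\le i\le D$). Fix $q$ with $b=q^2$.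 $V=\mathbb C^X$ with inner product $\langle u,v\rangle=u^t\overline v$. $E_0,\dots,E_D$ are the primitive idempotents of the Bose–Mesner algebra $M$ (spanned by the distance matrices $A_i$), ordered (possible since $\Gamma$ is formally self-dual) so that the Krein parameters $q^h_{ij}$ ($E_i\circ E_j=|X|^{-1}\sum_hq^h_{ij}E_h$) equal $p^h_{ij}$. $\theta_i$ is the eigenvalue of $A_1$ on $E_iV$. Fix a base vertex $x$; $E_i^*$ is diagonal with $(y,y)$-entry $1$ if $\partial(x,y)=i$ else $0$, spanning $M^*$; $A_1^*$ is diagonal with $(y,y)$-entry $|X|(E_1)_{xy}$, eigenvalue $\theta_i^*$ on $E_i^*V$. There are $\alpha_0,\alpha_1\in\mathbb C$, $\alpha_1\ne0$, with $\theta_i=\theta_i^*=\alpha_0+\alpha_1q^{D-2i}$; define $A,A^*$ by $A_1=\alpha_0I+\alpha_1A$, $A_1^*=\alpha_0I+\alpha_1A^*$. $T$ is the subalgebra of $\mathrm{Mat}_X(\mathbb C)$ generated by $M$ and $M^*$. For $-1\le i,j\le D$: $V^{\downarrow\downarrow}_{i,j}=(E^*_0V+\cdots+E^*_iV)\cap(E_0V+\cdots+E_jV)$, $V^{\uparrow\downarrow}_{i,j}=(E^*_DV+\cdots+E^*_{D-i}V)\cap(E_0V+\cdots+E_jV)$, $V^{\downarrow\uparrow}_{i,j}=(E^*_0V+\cdots+E^*_iV)\cap(E_DV+\cdots+E_{D-j}V)$, $V^{\uparrow\uparrow}_{i,j}=(E^*_DV+\cdots+E^*_{D-i}V)\cap(E_DV+\cdots+E_{D-j}V)$,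 each $0$ if $i=-1$ or $j=-1$. For $0\le i,j\le D$, $\tilde V^{\eta\mu}_{i,j}=(V^{\eta\mu}_{i-1,j}+V^{\eta\mu}_{i,j-1})^\perp\cap V^{\eta\mu}_{i,j}$; for each $\eta,\mu$, $V=\sum_{i,j}\tilde V^{\eta\mu}_{i,j}$ (direct sum). $B,B^*,K,K^*,\Phi,\Psi$ are the unique matrices such that for all $0\le i,j\le D$: $B$ acts as $q^{i-j}$ on $\tilde V^{\downarrow\uparrow}_{i,j}$; $B^*$ as $q^{j-i}$ on $\tilde V^{\uparrow\downarrow}_{i,j}$; $K$ as $q^{i-j}$ on $\tilde V^{\downarrow\downarrow}_{i,j}$; $K^*$ as $q^{i-j}$ on $\tilde V^{\uparrow\uparrow}_{i,j}$; $\Phi$ as $q^{i+j-D}$ on $\tilde V^{\downarrow\downarrow}_{i,j}$; $\Psi$ as $q^{i+j-D}$ on $\tilde V^{\downarrow\uparrow}_{i,j}$. There is a $\boxtimes_q$-module structure on $V$ in which $x_{01},x_{12},x_{23},x_{30},x_{02},x_{13}$ act as $A\Phi\Psi^{-1}$, $B\Phi^{-1}$, $A^*\Phi\Psi$, $B^*\Phi^{-1}$, $K\Psi^{-1}$, $K^*\Psi$ respectively; $\vartheta:\boxtimes_q\to\mathrm{Mat}_X(\mathbb C)$ denotes the $\mathbb C$-algebra homomorphism induced by this action. *)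

(* Defs.v *)
From HB Require Import structures.
From mathcomp Require Import all_boot all_order all_algebra generic_quotient.
From mathcomp Require Import boolp classical_sets reals.
From mathcomp Require Import complex.

Set Implicit Arguments.
Unset Strict Implicit.
Unset Printing Implicit Defensive.

Import Order.TTheory GRing.Theory Num.Theory.
Local Open Scope ring_scope.
Local Open Scope quotient_scope.

(* Unital associative K-algebras by generators and relations: the quotient of
   the formal expressions by the least congruence containing the axioms of a
   unital associative K-algebra and the given relations.  MathComp's algType
   demands 1 != 0, which is not available for an arbitrary presentation, so the
   quotient carries a pzRingType and an lmodType structure, tied together by
   presented_scaleAl and presented_scaleAr.  The universal property is given by
   presented_lift and presented_lift_uniq. *)

Inductive alg_expr (K I : Type) : Type :=
| AGen of I
| AScal of K
| AAdd of alg_expr K I & alg_expr K I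
| AMul of alg_expr K I & alg_expr K I.
Arguments AGen {K I}.
Arguments AScal {K I}.
Arguments AAdd {K I}.
Arguments AMul {K I}.

HB.instance Definition _ (K I : Type) := gen_eqMixin (alg_expr K I).
HB.instance Definition _ (K I : Type) := gen_choiceMixin (alg_expr K I).

Declare Scope alg_expr_scope.
Delimit Scope alg_expr_scope with alg.
Bind Scope alg_expr_scope with alg_expr.
Notation "u + v" := (AAdd u v) : alg_expr_scope.
Notation "u * v" := (AMul u v) : alg_expr_scope.
Notation "a *: u" := (AMul (AScal a) u) : alg_expr_scope.
Notation "u - v" := (AAdd u (AMul (AScal (-1)%R) v)) : alg_expr_scope.
Notation "u ^+ n" := (iter n (AMul u) (AScal 1%R)) : alg_expr_scope.

Section Presented.
Variables (K : comNzRingType) (I : Type).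
Local Notation expr := (alg_expr K I).
Variable rel : expr -> expr -> Prop.

Inductive alg_cong : expr -> expr -> Prop :=
| cong_rel u v : rel u v -> alg_cong u v
| cong_refl u : alg_cong u u
| cong_sym u v : alg_cong u v -> alg_cong v u
| cong_trans v u w : alg_cong u v -> alg_cong v w -> alg_cong u w
| cong_add u u' v v' : alg_cong u u' -> alg_cong v v' ->
    alg_cong (u + v)%alg (u' + v')%alg
| cong_mul u u' v v' : alg_cong u u' -> alg_cong v v' ->
    alg_cong (u * v)%alg (u' * v')%alg
| cong_addA u v w : alg_cong (u + (v + w))%alg (u + v + w)%alg
| cong_addC u v : alg_cong (u + v)%alg (v + u)%alg
| cong_add0 u : alg_cong (AScal 0 + u)%alg u
| cong_addN u : alg_cong (AScal (-1) * u + u)%alg (AScal 0)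
| cong_mulA u v w : alg_cong (u * (v * w))%alg (u * v * w)%alg
| cong_mul1 u : alg_cong (AScal 1 * u)%alg u
| cong_mulDl u v w : alg_cong ((u + v) * w)%alg (u * w + v * w)%alg
| cong_mulDr u v w : alg_cong (u * (v + w))%alg (u * v + u * w)%alg
| cong_scalD a b : alg_cong (AScal (a + b)) (AScal a + AScal b)%alg
| cong_scalM a b : alg_cong (AScal (a * b)) (AScal a * AScal b)%alg
| cong_scalC a u : alg_cong (AScal a * u)%alg (u * AScal a)%alg.

Definition alg_congb (u v : expr) : bool := `[< alg_cong u v >].

Fact alg_congb_refl : reflexive alg_congb.
Proof. by move=> u; apply/asboolP/cong_refl. Qed.

Fact alg_congb_sym : symmetric alg_congb.
Proof. by move=> u v; apply/asboolP/asboolP => /cong_sym. Qed.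

Fact alg_congb_trans : transitive alg_congb.
Proof.
by move=> v u w /asboolP uv /asboolP vw; apply/asboolP/(cong_trans uv).
Qed.

Canonical alg_cong_equiv :=
  EquivRel alg_congb alg_congb_refl alg_congb_sym alg_congb_trans.

Definition presented := {eq_quot alg_cong_equiv}.
HB.instance Definition _ := Choice.on presented.
HB.instance Definition _ := EqQuotient.on presented.

Definition presented_pi (u : expr) : presented := \pi_presented u.
Definition presented_gen (i : I) : presented := presented_pi (AGen i).

Lemma presented_piP (u v : expr) :
  presented_pi u = presented_pi v <-> alg_cong u v.
Proof. by split=> [/eqmodP /asboolP|uv]; last exact/eqmodP/asboolP. Qed.

Lemma presented_ind (P : presented -> Prop) :
  (forall u, P (presented_pi u)) -> forall x, P x.
Proof. by move=> Ppi x; elim/quotW: x => u; apply: Ppi. Qed.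

Lemma presented_reprP (u : expr) : alg_cong (repr (presented_pi u)) u.
Proof. by apply/presented_piP; rewrite /presented_pi reprK. Qed.

Definition presented_add (x y : presented) := presented_pi (repr x + repr y)%alg.
Definition presented_mul (x y : presented) := presented_pi (repr x * repr y)%alg.
Definition presented_scal (a : K) : presented := presented_pi (AScal a).

Lemma presented_addE u v :
  presented_add (presented_pi u) (presented_pi v) = presented_pi (u + v)%alg.
Proof. by apply/presented_piP/cong_add; apply: presented_reprP. Qed.

Lemma presented_mulE u v :
  presented_mul (presented_pi u) (presented_pi v) = presented_pi (u * v)%alg.
Proof. by apply/presented_piP/cong_mul; apply: presented_reprP. Qed.

Definition presented_opp (x : presented) := presented_mul (presented_scal (-1)) x.

Fact presented_addA : associative presented_add.
Proof.
elim/presented_ind=> u; elim/presented_ind=> v; elim/presented_ind=> w.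
by rewrite !presented_addE; apply/presented_piP/cong_addA.
Qed.

Fact presented_addC : commutative presented_add.
Proof.
elim/presented_ind=> u; elim/presented_ind=> v.
by rewrite !presented_addE; apply/presented_piP/cong_addC.
Qed.

Fact presented_add0 : left_id (presented_scal 0) presented_add.
Proof.
by elim/presented_ind=> u; rewrite presented_addE; apply/presented_piP/cong_add0.
Qed.

Fact presented_mulA : associative presented_mul.
Proof.
elim/presented_ind=> u; elim/presented_ind=> v; elim/presented_ind=> w.
by rewrite !presented_mulE; apply/presented_piP/cong_mulA.
Qed.

Fact presented_mul1l : left_id (presented_scal 1) presented_mul.
Proof.
by elim/presented_ind=> u; rewrite presented_mulE; apply/presented_piP/cong_mul1.
Qed.

Fact presented_scal_comm a x :
  presented_mul (presented_scal a) x = presented_mul x (presented_scal a).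
Proof.
elim/presented_ind: x => u.
by rewrite !presented_mulE; apply/presented_piP/cong_scalC.
Qed.

Fact presented_mul1r : right_id (presented_scal 1) presented_mul.
Proof. by move=> x; rewrite -presented_scal_comm presented_mul1l. Qed.

Fact presented_mulDl : left_distributive presented_mul presented_add.
Proof.
elim/presented_ind=> u; elim/presented_ind=> v; elim/presented_ind=> w.
by rewrite !(presented_addE, presented_mulE); apply/presented_piP/cong_mulDl.
Qed.

Fact presented_mulDr : right_distributive presented_mul presented_add.
Proof.
elim/presented_ind=> u; elim/presented_ind=> v; elim/presented_ind=> w.
by rewrite !(presented_addE, presented_mulE); apply/presented_piP/cong_mulDr.
Qed.

Fact presented_scalD a b :
  presented_scal (a + b) = presented_add (presented_scal a) (presented_scal b).
Proof. by rewrite presented_addE; apply/presented_piP/cong_scalD. Qed.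

Fact presented_scalM a b :
  presented_scal (a * b) = presented_mul (presented_scal a) (presented_scal b).
Proof. by rewrite presented_mulE; apply/presented_piP/cong_scalM. Qed.

Fact presented_addN : left_inverse (presented_scal 0) presented_opp presented_add.
Proof.
elim/presented_ind=> u; rewrite /presented_opp presented_mulE presented_addE.
exact/presented_piP/cong_addN.
Qed.

HB.instance Definition _ := GRing.isZmodule.Build presented
  presented_addA presented_addC presented_add0 presented_addN.
HB.instance Definition _ := GRing.Zmodule_isPzRing.Build presented
  presented_mulA presented_mul1l presented_mul1r
  presented_mulDl presented_mulDr.

Definition presented_scale (a : K) (x : presented) : presented :=
  presented_scal a * x.

Fact presented_scaleA a b x :
  presented_scale a (presented_scale b x) = presented_scale (a * b) x.
Proof.
by rewrite /presented_scale mulrA; congr (_ * _); rewrite presented_scalM.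
Qed.

Fact presented_scale1 : left_id 1 presented_scale.
Proof. exact: presented_mul1l. Qed.

Fact presented_scaleDr : right_distributive presented_scale +%R.
Proof. by move=> a x y; apply: mulrDr. Qed.

Fact presented_scaleDl x : {morph presented_scale^~ x : a b / a + b}.
Proof.
move=> a b; rewrite /presented_scale -mulrDl; congr (_ * _).
exact: presented_scalD.
Qed.

HB.instance Definition _ := GRing.Zmodule_isLmodule.Build K presented
  presented_scaleA presented_scale1 presented_scaleDr presented_scaleDl.

Lemma presented_scaleAl (a : K) (x y : presented) : a *: (x * y) = a *: x * y.
Proof. exact: mulrA. Qed.

Lemma presented_scaleAr (a : K) (x y : presented) : a *: (x * y) = x * (a *: y).
Proof.
rewrite /GRing.scale /= /presented_scale !mulrA; congr (_ * _).
exact: presented_scal_comm.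
Qed.

Lemma presented_piD u v :
  presented_pi (u + v)%alg = presented_pi u + presented_pi v.
Proof. by rewrite -presented_addE. Qed.

Lemma presented_piM u v :
  presented_pi (u * v)%alg = presented_pi u * presented_pi v.
Proof. by rewrite -presented_mulE. Qed.

Lemma presented_piZ (a : K) : presented_pi (AScal a) = a *: (1 : presented).
Proof. by rewrite /GRing.scale /= /presented_scale mulr1. Qed.

Fixpoint alg_eval (B : algType K) (f : I -> B) (u : expr) : B :=
  match u with
  | AGen i => f i
  | AScal a => a *: 1
  | AAdd u v => alg_eval f u + alg_eval f v
  | AMul u v => alg_eval f u * alg_eval f v
  end.

Lemma alg_eval_cong (B : algType K) (f : I -> B) :
  (forall u v, rel u v -> alg_eval f u = alg_eval f v) ->
  forall u v, alg_cong u v -> alg_eval f u = alg_eval f v.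
Proof.
move=> frel u v; elim=> {u v} //=.
- by move=> u v w _ -> _ ->.
- by move=> u u' v v' _ -> _ ->.
- by move=> u u' v v' _ -> _ ->.
- by move=> u v w; rewrite addrA.
- by move=> u v; rewrite addrC.
- by move=> u; rewrite scale0r add0r.
- by move=> u; rewrite scale0r scaleN1r mulN1r addNr.
- by move=> u v w; rewrite mulrA.
- by move=> u; rewrite scale1r mul1r.
- by move=> u v w; rewrite mulrDl.
- by move=> u v w; rewrite mulrDr.
- by move=> a b; rewrite scalerDl.
- by move=> a b; rewrite -scalerAl mul1r scalerA.
- by move=> a u; rewrite -scalerAl -scalerAr mul1r mulr1.
Qed.

Lemma presented_lift (B : algType K) (f : I -> B) :
  (forall u v, rel u v -> alg_eval f u = alg_eval f v) ->
  exists phi : {rmorphism presented -> B},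
    scalable phi /\ forall i, phi (presented_gen i) = f i.
Proof.
move=> frel; pose phi (x : presented) := alg_eval f (repr x).
have phi_pi u : phi (presented_pi u) = alg_eval f u.
  by apply: alg_eval_cong => //; apply: presented_reprP.
have phiB : {morph phi : x y / x - y}.
  elim/presented_ind=> u; elim/presented_ind=> v.
  have -> : presented_pi u - presented_pi v = presented_pi (u - v)%alg.
    by rewrite presented_piD presented_piM.
  by rewrite !phi_pi /= scaleN1r mulN1r.
have phiM : monoid_morphism phi.
  split; first by rewrite [phi _]phi_pi /= scale1r.
  elim/presented_ind=> u; elim/presented_ind=> v.
  by rewrite -presented_piM !phi_pi.
pose h1 := GRing.isZmodMorphism.Build presented B phi phiB.
pose h2 := GRing.isMonoidMorphism.Build presented B phi phiM.
pose phiR : {rmorphism presented -> B} := HB.pack phi h1 h2.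
exists phiR; split=> [a|i]; last exact: (phi_pi (AGen i)).
elim/presented_ind=> u.
have -> : a *: presented_pi u = presented_pi (a *: u)%alg.
  by rewrite presented_piM presented_piZ -presented_scaleAl mul1r.
by rewrite [LHS]phi_pi [X in _ *: X]phi_pi /= -scalerAl mul1r.
Qed.

Lemma presented_lift_uniq (B : algType K) (phi psi : {rmorphism presented -> B}) :
  scalable phi -> scalable psi ->
  (forall i, phi (presented_gen i) = psi (presented_gen i)) -> phi =1 psi.
Proof.
move=> phiZ psiZ eq_gen x; elim/presented_ind: x => u.
elim: u => [i|a|u IHu v IHv|u IHu v IHv].
- exact: eq_gen.
- by rewrite presented_piZ phiZ psiZ !rmorph1.
- by rewrite presented_piD !rmorphD IHu IHv.
- by rewrite presented_piM !rmorphM IHu IHv.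
Qed.

End Presented.

Section Qtetrahedron.
Variables (K : fieldType) (q : K).

Definition qint (n : nat) : K := (q ^+ n - q ^- n) / (q - q^-1).

Definition arc (i j : 'Z_4) : bool := (j - i == 1) || (j - i == 2).

Definition qtet_index := {ij : 'Z_4 * 'Z_4 | arc ij.1 ij.2}.

Local Notation X := (fun i j (a : arc i j) =>
  AGen (exist (fun ij : 'Z_4 * 'Z_4 => arc ij.1 ij.2) (i, j) a)).

Inductive qtet_rel : alg_expr K qtet_index -> alg_expr K qtet_index -> Prop :=
| qtet_inv i j (ij : arc i j) (ji : arc j i) : j - i = 2 ->
    qtet_rel (X i j ij * X j i ji)%alg (AScal 1)
| qtet_weyl h i j (hi : arc h i) (ij : arc i j) :
    (i - h, j - i) \in [:: (1, 1); (1, 2); (2, 1)] ->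
    qtet_rel
      ((q - q^-1)^-1 *:
        (q *: (X h i hi * X i j ij) - q^-1 *: (X i j ij * X h i hi)))%alg
      (AScal 1)
| qtet_serre h i j k (hi : arc h i) (jk : arc j k) :
    i - h = 1 -> j - i = 1 -> k - j = 1 ->
    qtet_rel
      (X h i hi ^+ 3 * X j k jk
       - qint 3 *: (X h i hi ^+ 2 * X j k jk * X h i hi)
       + qint 3 *: (X h i hi * X j k jk * X h i hi ^+ 2)
       - X j k jk * X h i hi ^+ 3)%alg
      (AScal 0).

Definition qtet := presented qtet_rel.
HB.instance Definition _ := GRing.PzRing.on qtet.
HB.instance Definition _ := GRing.Lmodule.on qtet.

Definition qtet_x (i j : 'Z_4) (a : arc i j) : qtet := presented_pi _ (X i j a).

End Qtetrahedron.
Arguments qtet_x {K} q i j a.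

Section Graph.
Variables (X : finType) (e : rel X).

(* The length of a shortest walk from y to z, and #|X| if there is none. *)
Definition gdist (y z : X) : nat :=
  find (fun k => [exists w : k.-tuple X, path e y w && (last y w == z)])
       (iota 0 #|X|).

Definition diameter : nat := \max_(y : X) \max_(z : X) gdist y z.

Definition graph_connected : Prop := forall y z, connect e y z.

(* p h i j is the intersection number $p^h_{ij}$; its values for h larger than
   the diameter are irrelevant. *)
Definition distance_regular (p : nat -> nat -> nat -> nat) : Prop :=
  forall (h i j : nat) (y z : X), gdist y z = h ->
    #|[set w | (gdist y w == i) && (gdist w z == j)]| = p h i j.

End Graph.

(* $c_0 = p^0_{1,-1}$ is 0. *)
Definition cnum (p : nat -> nat -> nat -> nat) (i : nat) : nat :=
  if i is i'.+1 then p i 1%N i' else 0%N.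
Definition bnum (p : nat -> nat -> nat -> nat) (i : nat) : nat := p i 1%N i.+1.

Definition subalgebra (K : pzRingType) (n : nat) : set (set 'M[K]_n) :=
  [set S | [/\ S 1%:M,
               forall (a : K) u v, S u -> S v -> S (a *: u + v)
             & forall u v, S u -> S v -> S (u *m v)]].

Definition generated_algebra (K : pzRingType) (n : nat) (G : set 'M[K]_n) :
  set 'M[K]_n := smallest (@subalgebra K n) G.

Definition primitive_idempotent (K : fieldType) (n : nat)
    (M : {vspace 'M[K]_n}) (F : 'M[K]_n) : Prop :=
  [/\ F \in M, F != 0, F *m F = F &
    forall G H : 'M[K]_n, G \in M -> H \in M ->
      G *m G = G -> H *m H = H -> G *m H = 0 -> H *m G = 0 ->
      F = G + H -> G = 0 \/ H = 0].

(* Matrices with rows and columns indexed by X are encoded in 'M_#|X| through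
   enum_val and enum_rank. *)
Section Terwilliger.
Variables (C : numClosedFieldType) (X : finType) (e : rel X) (D : nat).
Local Notation Mat := 'M[C]_#|X|.

Definition dist_mx (i : nat) : Mat :=
  \matrix_(s, t) (gdist e (enum_val s) (enum_val t) == i)%:R.

Definition bose_mesner : {vspace Mat} :=
  <<[seq dist_mx i | i : 'I_D.+1]>>%VS.

Definition is_primitive_idempotents (E : 'I_D.+1 -> Mat) : Prop :=
  injective E /\
  forall F, primitive_idempotent bose_mesner F <-> exists i, F = E i.

(* kr h i j is the Krein parameter $q^h_{ij}$. *)
Definition is_krein (E : 'I_D.+1 -> Mat)
    (kr : 'I_D.+1 -> 'I_D.+1 -> 'I_D.+1 -> C) : Prop :=
  forall i j, map2_mx *%R (E i) (E j) =
              #|X|%:R^-1 *: \sum_(h < D.+1) kr h i j *: E h.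

Variable x : X.

Definition dual_idem (i : 'I_D.+1) : Mat :=
  diag_mx (\row_s (gdist e x (enum_val s) == i)%:R).

Definition dual_bose_mesner : {vspace Mat} :=
  <<[seq dual_idem i | i : 'I_D.+1]>>%VS.

Definition dual_adjacency (E : 'I_D.+1 -> Mat) : Mat :=
  diag_mx (\row_s (#|X|%:R * E (inord 1) (enum_rank x) s)).

Definition terwilliger : set Mat :=
  generated_algebra ([set` bose_mesner] `|` [set` dual_bose_mesner])%classic.

End Terwilliger.
Arguments dist_mx C {X} e i.
Arguments bose_mesner C {X} e D.
Arguments dual_idem C {X} e {D} x i.
Arguments dual_bose_mesner C {X} e D x.
Arguments terwilliger C {X} e D x.

Section SplitDecomposition.
Variables (C : numClosedFieldType) (n D : nat).
Local Notation V := 'cV[C]_n.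
Local Notation Mat := 'M[C]_n.

Definition hdot (u v : V) : C := \sum_s u s 0 * (v s 0)^*.

Definition mx_image (F : Mat) : {vspace V} :=
  limg (linfun (mulmx F)).

Inductive direction := Down | Up.

(* F_0 V + ... + F_i V for Down, F_D V + ... + F_(D-i) V for Up; this is 0 for
   i = -1. *)
Definition flag (d : direction) (F : 'I_D.+1 -> Mat) (i : int) : {vspace V} :=
  match d with
  | Down => \sum_(k < D.+1 | (k%:Z <= i)%R) mx_image (F k)
  | Up => \sum_(k < D.+1 | (D%:Z - i <= k%:Z)%R) mx_image (F k)
  end%VS.

Variables (Es E : 'I_D.+1 -> Mat).

Definition split_space (eta mu : direction) (i j : int) : {vspace V} :=
  (flag eta Es i :&: flag mu E j)%VS.

Definition split_perp (eta mu : direction) (i j : int) : set V :=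
  [set v | v \in split_space eta mu i j /\
     forall u, u \in (split_space eta mu (i - 1) j
                      + split_space eta mu i (j - 1))%VS -> hdot u v = 0]%classic.

Definition acts_on_split (eta mu : direction) (w : int -> int -> C) (F : Mat) :
  Prop :=
  forall (i j : 'I_D.+1) (v : V),
    split_perp eta mu i%:Z j%:Z v -> F *m v = w i%:Z j%:Z *: v.

End SplitDecomposition.

(* Main.v *)
(* The flags attached to the E_i and the E*_i are ranges of orthogonal projections
   in T.  For Hermitian H in T, the projection on ker H is a polynomial in H,
   hence in T; intersections, and orthogonal complements of sums, of ranges of
   projections in T are kernels of sums of such projections.  So each split
   component is the range of a projection P_ij in T.  By induction on i + j the
   components span V, hence 1 = sum P_ij W with W in T, and a matrix F acting as
   the scalar w_ij on each component is sum w_ij P_ij W, which lies in T.  This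
   puts B, B*, K, K*, Phi, Psi in T, and their inverses too, which is (i).
   Conversely A = x01 Psi Phi^-1 and A* = x23 Psi^-1 Phi^-1; since the theta_i are
   distinct (because c_k <> 0 for 0 < k <= D), Lagrange interpolation at A_1 and
   A*_1 recovers the E_i and the E*_i, which span M and M*. *)

Require Import Defs.
From HB Require Import structures.
From mathcomp Require Import all_boot all_order all_algebra.
From mathcomp Require Import boolp classical_sets reals.
From mathcomp Require Import complex.
From mathcomp Require Import zify.
Set Implicit Arguments.
Unset Strict Implicit.
Unset Printing Implicit Defensive.
Import Order.TTheory GRing.Theory Num.Theory.
Local Open Scope classical_set_scope.
Local Open Scope ring_scope.
Local Open Scope sesquilinear_scope.

(** * Subalgebras of matrices and orthogonal projections *)

Section Subalgebra.
Variables (K : fieldType) (n : nat) (S : set 'M[K]_n).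
Hypothesis algS : subalgebra S.

Lemma subalg1 : S 1%:M. Proof. by case: algS. Qed.

Lemma subalgM u v : S u -> S v -> S (u *m v).
Proof. by case: algS => _ _; apply. Qed.

Lemma subalg0 : S 0.
Proof.
by case: algS => S1 SZD _; move: (SZD (-1) _ _ S1 S1); rewrite scaleN1r addNr.
Qed.

Lemma subalgZ a u : S u -> S (a *: u).
Proof. by case: algS => _ SZD _ Su; rewrite -[_ *: _]addr0; exact: SZD subalg0. Qed.

Lemma subalgD u v : S u -> S v -> S (u + v).
Proof. by case: algS => _ SZD _ Su Sv; rewrite -[u]scale1r; apply: SZD. Qed.

Lemma subalgB u v : S u -> S v -> S (u - v).
Proof. by move=> Su Sv; rewrite -scaleN1r; apply: subalgD => //; apply: subalgZ. Qed.

Lemma subalg_sum I (r : seq I) (P : pred I) (F : I -> 'M[K]_n) :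
  (forall i, P i -> S (F i)) -> S (\sum_(i <- r | P i) F i).
Proof. by move=> SF; elim/big_ind: _ => //; [exact: subalg0 | exact: subalgD]. Qed.

Lemma subalg_scalar a : S a%:M.
Proof. by rewrite -scalemx1; apply/subalgZ/subalg1. Qed.

Lemma subalg_span (I : finType) (F : I -> 'M[K]_n) H :
  (forall i, S (F i)) -> H \in <<[seq F i | i : I]>>%VS -> S H.
Proof.
move=> SF; rewrite -[[seq F i | i : I]]/(val (in_tuple [seq F i | i : I])).
move=> /coord_span ->; apply: subalg_sum => i _; apply: subalgZ => /=.
have /mapP[j _ ->] : [seq F i | i : I]`_i \in [seq F i | i : I] by apply: mem_nth.
exact: SF.
Qed.

End Subalgebra.

Lemma generated_subalgebra (K : fieldType) n (G : set 'M[K]_n) :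
  subalgebra (generated_algebra G).
Proof.
split=> [S [algS _]|a u v Gu Gv S SG|u v Gu Gv S SG]; first exact: subalg1.
  apply: subalgD; [exact: SG.1| apply: subalgZ; [exact: SG.1|exact: Gu]|exact: Gv].
by apply: subalgM; [exact: SG.1|exact: Gu|exact: Gv].
Qed.

Lemma subalg_horner (K : fieldType) n (S : set 'M[K]_n.+1) H p :
  subalgebra S -> S H -> S (horner_mx H p).
Proof.
move=> algS SH; elim/poly_ind: p => [|p c IHp].
  by rewrite rmorph0; apply: subalg0.
rewrite rmorphD rmorphM /= horner_mx_X horner_mx_C.
by apply: (subalgD algS); [exact: (subalgM algS) | exact: subalg_scalar].
Qed.

(* With [r] the part of the characteristic polynomial of [H] prime to 'X,
   [P] is [r(H) / r(0)]: the projection on the generalized kernel of [H]. *)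
Lemma subalg_fitting (K : fieldType) n (S : set 'M[K]_n) H :
  subalgebra S -> S H ->
  exists k P W,
    [/\ S P, S W, iter k (mulmx H) P = 0 & 1%:M - P = H *m W].
Proof.
case: n S H => [|n] S H algS SH.
  exists 0%N, 0, 0; split; try exact: subalg0; rewrite //.
  by rewrite [LHS]flatmx0 [RHS]flatmx0.
have [m [r]] := multiplicity_XsubC (char_poly H) 0.
rewrite monic_neq0 ?char_poly_monic //; case=> /= r0 chE.
(* Dividing [r - r(0)] by 'X gives [s], and [W = - s(H) / r(0)] then satisfies [1 - P = H W]. *)
have /factor_theorem[s rE] : root (r - r.[0]%:P) 0.
  by rewrite /root !hornerE subrr.
rewrite subr0 in rE chE; set c := r.[0] in rE.
have c0 : c != 0 by [].
exists m, (c^-1 *: horner_mx H r), (- c^-1 *: horner_mx H s); split.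
- by apply: (subalgZ algS); apply: subalg_horner.
- by apply: (subalgZ algS); apply: subalg_horner.
- have -> : iter m (mulmx H) (c^-1 *: horner_mx H r)
            = c^-1 *: horner_mx H (r * 'X ^+ m).
    elim: m {chE} => [|m IHm]; first by rewrite mulr1.
    rewrite iterS IHm -scalemxAr; congr (_ *: _).
    by rewrite exprS mulrCA [in RHS]rmorphM /= horner_mx_X.
  by rewrite -chE Cayley_Hamilton scaler0.
- rewrite -scalemxAr scaleNr.
  have -> : H *m horner_mx H s = horner_mx H (s * 'X).
    by rewrite mulrC [in RHS]rmorphM /= horner_mx_X.
  rewrite -rE rmorphB /= horner_mx_C scalerBr -(scalemx1 _ c) scalerA mulVf //.
  by rewrite scale1r opprB.
Qed.

(** An invertible [H] has zero generalized kernel, so [P = 0] in [subalg_fitting] and the inverse is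
    the [W] found there. For singular [H], [invmx H] is [H] itself. *)
Lemma subalg_invmx (K : fieldType) n (S : set 'M[K]_n) H :
  subalgebra S -> S H -> S (invmx H).
Proof.
move=> algS SH; have [uH|nuH] := boolP (H \in unitmx); last first.
  by rewrite /invmx (negPf nuH).
have [k [P [W [_ SW HP PW]]]] := subalg_fitting algS SH.
have P0 : P = 0.
  elim: k HP => //= k IHk /(congr1 (mulmx (invmx H))).
  by rewrite mulKmx // mulmx0.
by rewrite -[invmx H]mulmx1 -[1%:M]subr0 -{1}P0 PW mulKmx.
Qed.

(** * Orthogonal projections inside a subalgebra of complex matrices *)

Section Hermitian.
Variable C : numClosedFieldType.

Lemma trmxC_mul m n k (M : 'M[C]_(m, n)) (N : 'M_(n, k)) :
  (M *m N)^t* = N^t* *m M^t*.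
Proof. by rewrite trmx_mul map_mxM. Qed.

Lemma gram_eq0 m n (M : 'M[C]_(m, n)) : M^t* *m M = 0 -> M = 0.
Proof.
move=> MM0; apply/matrixP => i j; have := congr1 (fun N : 'M_n => N j j) MM0.
rewrite !mxE => /psumr_eq0P H.
have entryE k : (M^t* ) j k * M k j = `|M k j| ^+ 2 by rewrite !mxE mulrC -normCK.
apply/eqP; rewrite -normr_eq0 -sqrf_eq0 -entryE; apply/eqP/H => // k _.
by rewrite entryE exprn_ge0.
Qed.

Definition orthoproj n (P : 'M[C]_n) := P^t* = P /\ P *m P = P.

Lemma orthoprojC n (P : 'M[C]_n) : orthoproj P -> orthoproj (1%:M - P).
Proof.
case=> hP PP; split; first by rewrite linearB /= map_mxB hP trmx1 map_mx1.
by rewrite mulmxBl mul1mx mulmxBr mulmx1 PP subrr subr0.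
Qed.

Lemma orthoproj_sum n (I : finType) (c : pred I) (F : I -> 'M[C]_n) :
  (forall i, orthoproj (F i)) -> (forall i j, i != j -> F i *m F j = 0) ->
  orthoproj (\sum_(i | c i) F i).
Proof.
move=> oF F0; split.
  by rewrite raddf_sum /= map_mx_sum; apply: eq_bigr => i _; case: (oF i).
rewrite mulmx_suml; apply: eq_bigr => i ci.
rewrite mulmx_sumr (bigD1 i) //= big1 => [|j /andP[_ ji]]; last first.
  by apply: F0; rewrite eq_sym.
by rewrite addr0; case: (oF i).
Qed.

(* <v, sum_i P_i v> = sum_i |P_i v|^2 *)
Lemma sum_orthoproj_ker n (I : finType) (P : I -> 'M[C]_n) (v : 'cV_n) :
  (forall i, orthoproj (P i)) ->
  (\sum_i P i) *m v = 0 -> forall i, P i *m v = 0.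
Proof.
move=> oP /(congr1 (mulmx (v^t* ))) /(congr1 (fun N : 'M_1 => N 0 0)).
rewrite mulmx0 mulmx_suml mulmx_sumr summxE mxE.
have PE i : (v^t* *m (P i *m v)) 0 0 = ((P i *m v)^t* *m (P i *m v)) 0 0.
  by case: (oP i) => hP PP; rewrite trmxC_mul hP -mulmxA [P i *m (_ *m _)]mulmxA PP.
have P_ge0 i : 0 <= (v^t* *m (P i *m v)) 0 0.
  rewrite PE mxE; apply: sumr_ge0 => k _.
  by rewrite !mxE mulrC -normCK exprn_ge0.
move=> /psumr_eq0P H i; apply: gram_eq0; rewrite [LHS]mx11_scalar -PE H //.
by rewrite -scalemx1 scale0r.
Qed.

Variables (n : nat) (S : set 'M[C]_n).
Hypothesis algS : subalgebra S.

(** For Hermitian [H] the generalized kernel is the kernel, because [H (H N) = 0] forces [H N = 0]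
    by [gram_eq0]. From [1 - P = H W] one gets [(1 - P^t* ) P = W^t* H P = 0], so [P = P^t* P] is
    Hermitian and idempotent. *)
Lemma hermitian_kernel_orthoproj H : S H -> H^t* = H ->
  exists P W,
  [/\ S P, S W, orthoproj P, H *m P = 0 & 1%:M - P = H *m W].
Proof.
move=> SH hH; have [k [P [W [SP SW HP PW]]]] := subalg_fitting algS SH.
exists P, W.
have {}HP : H *m P = 0.
  case: k HP => [/= ->|k HP]; first by rewrite mulmx0.
  elim: k HP => //= k IHk HP; apply: IHk; apply: gram_eq0.
  by rewrite trmxC_mul hH -mulmxA HP mulmx0.
have PE : P = P^t* *m P.
  apply/eqP; rewrite -subr_eq0 -{1}[P]mul1mx -mulmxBl.
  have -> : 1%:M - P^t* = W^t* *m H.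
    by rewrite -[X in _ = _ *m X]hH -trmxC_mul -PW linearB /= map_mxB trmx1 map_mx1.
  by rewrite -mulmxA HP mulmx0.
have hP : P^t* = P by rewrite [in LHS]PE trmxC_mul trmxCK -PE.
by split => //; split => //; rewrite -{1}hP -PE.
Qed.

(** Orthogonal projections are positive semidefinite, so the kernel of their sum is the intersection
    of their kernels. The matrix [W] records how the complement of that kernel is spread over the
    ranges of the [P i]; it later serves to decompose vectors and to write 1 in terms of the
    [P i]. *)
Lemma common_kernel_orthoproj (I : finType) (P : I -> 'M[C]_n) :
  (forall i, S (P i)) -> (forall i, orthoproj (P i)) ->
  exists Q W, [/\ S Q, S W, orthoproj Q,
    forall v : 'cV_n, Q *m v = v <-> forall i, P i *m v = 0 &
    1%:M - Q = \sum_i P i *m W].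
Proof.
move=> SP oP.
have [Q [W [SQ SW oQ HQ QW]]] : exists P0 W, [/\ S P0, S W, orthoproj P0,
    (\sum_i P i) *m P0 = 0 & 1%:M - P0 = (\sum_i P i) *m W].
  apply: hermitian_kernel_orthoproj; first exact: (subalg_sum algS).
  by rewrite raddf_sum /= map_mx_sum; apply: eq_bigr => i _; case: (oP i).
exists Q, W; split=> //; last by rewrite QW mulmx_suml.
move=> v; split=> [Qv|Pv].
  by apply: sum_orthoproj_ker => //; rewrite -Qv mulmxA HQ mul0mx.
(* Taking adjoints in the formula for [1 - Q] puts the [P i] on the right of [W^t*], where they meet
   [v]. *)
have hE : (1%:M - Q)^t* = 1%:M - Q by case: (orthoprojC oQ).
apply/esym/eqP; rewrite -subr_eq0 -{1}[v]mul1mx -mulmxBl -hE QW trmxC_mul.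
rewrite raddf_sum /= map_mx_sum -mulmxA mulmx_suml big1 ?mulmx0 // => i _.
by case: (oP i) => -> _; exact: Pv.
Qed.

(** The range is a plain set, not a [vspace], because [split_perp] is defined as a set. *)
Definition orthoproj_on (W : set 'cV[C]_n) P :=
  [/\ S P, orthoproj P & forall v, W v <-> P *m v = v].

(** The intersection of two ranges is the common kernel of the complementary projections [1 - P] and
    [1 - Q]. *)
Lemma orthoproj_cap U W P Q : orthoproj_on U P -> orthoproj_on W Q ->
  exists N, orthoproj_on (U `&` W) N.
Proof.
move=> [SP oP UP] [SQ oQ WQ].
pose F (t : bool) := 1%:M - (if t then P else Q).
have [N [_ [SN _ oN NF _]]] := @common_kernel_orthoproj bool F
  ltac:(by case; apply: (subalgB algS) => //; apply: subalg1)
  ltac:(by case; apply: orthoprojC).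
exists N; split=> // v; rewrite NF.
have FE t : F t *m v = 0 <-> (if t then P else Q) *m v = v.
  rewrite /F mulmxBl mul1mx; split=> [/eqP|->]; last by rewrite subrr.
  by rewrite subr_eq0 => /eqP.
split=> [[/UP Pv /WQ Qv] t|H]; first by apply/FE; case: t.
by split; [apply/UP/(FE true) | apply/WQ/(FE false)].
Qed.

Lemma hdotE (u v : 'cV[C]_n) : hdot u v = (v^t* *m u) 0 0.
Proof. by rewrite mxE; apply: eq_bigr => s _; rewrite !mxE mulrC. Qed.

Lemma hdot_eq0 (u : 'cV[C]_n) : hdot u u = 0 -> u = 0.
Proof.
rewrite hdotE => u0; apply: gram_eq0; rewrite [LHS]mx11_scalar u0.
by rewrite -scalemx1 scale0r.
Qed.

Lemma hdot_orthoproj P (u v : 'cV[C]_n) : orthoproj P ->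
  hdot (P *m u) v = hdot u (P *m v).
Proof. by case=> hP _; rewrite !hdotE trmxC_mul hP mulmxA. Qed.

End Hermitian.

(** * Split decompositions *)

Lemma mx_imageP (C : numClosedFieldType) n (F : 'M[C]_n) v :
  v \in mx_image F <-> exists u, v = F *m u.
Proof.
split=> [/memv_imgP[u _ ->]|[u ->]]; first by exists u; rewrite lfunE.
by apply/memv_imgP; exists u; rewrite ?memvf // lfunE.
Qed.

Section Split.
Variables (C : numClosedFieldType) (n D : nat) (S : set 'M[C]_n).
Hypothesis algS : subalgebra S.

Definition resolution (F : 'I_D.+1 -> 'M[C]_n) :=
  [/\ forall i, S (F i), forall i, orthoproj (F i),
      forall i j, i != j -> F i *m F j = 0 & \sum_i F i = 1%:M].

Lemma sum_mx_imageP F (c : pred 'I_D.+1) v : resolution F ->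
  v \in (\sum_(k < D.+1 | c k) mx_image (F k))%VS <->
  (\sum_(k < D.+1 | c k) F k) *m v = v.
Proof.
case=> SF oF F0 _; split=> [/memv_sumP[w wF ->]|<-].
  rewrite mulmx_sumr; apply: eq_bigr => k ck.
  have [u ->] := (mx_imageP (F k) (w k)).1 (wF k ck).
  rewrite mulmx_suml (bigD1 k) //= big1 ?addr0 => [|j /andP[_ jk]].
    by rewrite mulmxA; case: (oF k) => _ ->.
  by rewrite mulmxA F0 // mul0mx.
apply/memv_sumP; exists (fun k => F k *m v); last by rewrite mulmx_suml.
by move=> k _; apply/mx_imageP; exists v.
Qed.

Lemma flag_orthoproj F d i : resolution F ->
  exists P, orthoproj_on S [set` flag d F i] P.
Proof.
move=> rF; have [SF oF F0 _] := rF.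
have sumF (c : pred 'I_D.+1) : exists P,
    orthoproj_on S [set` (\sum_(k < D.+1 | c k) mx_image (F k))%VS] P.
  exists (\sum_(k < D.+1 | c k) F k); split; first exact: (subalg_sum algS).
    exact: orthoproj_sum.
  by move=> v; exact: sum_mx_imageP.
by case: d; apply: sumF.
Qed.

Lemma flag_mono (F : 'I_D.+1 -> 'M[C]_n) d i j :
  (i <= j)%R -> (flag d F i <= flag d F j)%VS.
Proof.
move=> ij; case: d; apply/subv_sumP => k ck.
  by apply: sumv_sup (subvv _); apply: le_trans ij.
by apply: sumv_sup (subvv _); apply: le_trans ck; rewrite lerD2l lerN2.
Qed.

(** The index -1 is kept in the form [0 - 1] in which it arises from [i - 1] in [split_perp]; this
    ends the induction in [split_perp_span]. *)
Lemma flag_Npos (F : 'I_D.+1 -> 'M[C]_n) d : flag d F (0 - 1) = 0%VS.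
Proof.
case: d; apply: big_pred0 => k; apply/negbTE; rewrite -ltNge sub0r ?opprK.
  by apply: lt_le_trans (ltrN10 _) _.
by rewrite -PoszD ltz_nat addn1 ltn_ord.
Qed.

Lemma flag_full F d v : resolution F -> v \in flag d F D%:Z.
Proof.
move=> rF; case: (rF) => _ _ _ F1.
case: d; apply/sum_mx_imageP => //.
  by rewrite (eq_bigl xpredT) ?F1 ?mul1mx // => k; rewrite lez_nat -ltnS ltn_ord.
by rewrite (eq_bigl xpredT) ?F1 ?mul1mx // => k; rewrite subrr.
Qed.

Variables (Es E : 'I_D.+1 -> 'M[C]_n).
Hypotheses (resEs : resolution Es) (resE : resolution E).
Variables eta mu : direction.
Local Notation Vij := (split_space Es E eta mu).
Local Notation tVij := (split_perp Es E eta mu).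

Lemma split_space_orthoproj i j : exists P, orthoproj_on S [set` Vij i j] P.
Proof.
have [P1 oP1] := flag_orthoproj eta i resEs.
have [P2 oP2] := flag_orthoproj mu j resE.
have [P [SP oP PP]] := orthoproj_cap algS oP1 oP2.
exists P; split=> // v; rewrite -PP /=.
by split=> [/memv_capP|[? ?]] //; apply/memv_capP.
Qed.

(** The orthogonal complement of a sum of two ranges is the common kernel of the two projections, so
    the component is an intersection of two ranges of projections in [S]. The second half is the
    orthogonal decomposition of a vector of the split space, which drives the induction on
    [i + j]. *)
Lemma split_perp_orthoproj i j :
  (exists P, orthoproj_on S (tVij i j) P) /\
  forall v, v \in Vij i j -> exists u1 u2,
    [/\ u1 \in Vij (i - 1) j, u2 \in Vij i (j - 1) & tVij i j (v - u1 - u2)].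
Proof.
have [P1 [SP1 oP1 VP1]] := split_space_orthoproj (i - 1) j.
have [P2 [SP2 oP2 VP2]] := split_space_orthoproj i (j - 1).
have [P0 PV] := split_space_orthoproj i j.
have [N [W [SN _ oN NV NW]]] := @common_kernel_orthoproj _ _ S algS bool
  (fun t => if t then P1 else P2) ltac:(by case) ltac:(by case).
have NperpP v : N *m v = v <-> forall u, u \in (Vij (i - 1) j + Vij i (j - 1))%VS
    -> hdot u v = 0.
  rewrite NV; split=> [Pv u /memv_addP[u1 /VP1 u1P [u2 /VP2 u2P ->]]|H].
    rewrite hdotE mulmxDr mxE -!hdotE -u1P -u2P !hdot_orthoproj //.
    rewrite (Pv true) (Pv false) !hdotE.
    by rewrite trmx0 map_mx0 !mul0mx mxE addr0.
  (* Orthogonality is tested on [P1 v] and [P2 v] themselves, since [<P v, P v> = <P v, v>]. *)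
  case; apply: hdot_eq0; rewrite -hdot_orthoproj //.
    have [_ PP] := oP1; rewrite mulmxA PP; apply: H.
    by apply: (subvP (addvSl _ _)); apply/VP1; rewrite mulmxA PP.
  have [_ PP] := oP2; rewrite mulmxA PP; apply: H.
  by apply: (subvP (addvSr _ _)); apply/VP2; rewrite mulmxA PP.
have tVE : tVij i j = [set` Vij i j] `&` [set v | N *m v = v].
  by apply/seteqP; split=> v [Vv /NperpP].
split.
  by rewrite tVE; apply: (orthoproj_cap algS PV (Q := N)); split.
move=> v Vv; have PV1 u : P1 *m u \in Vij (i - 1) j.
  by apply/VP1; case: oP1 => _ PP; rewrite mulmxA PP.
have PV2 u : P2 *m u \in Vij i (j - 1).
  by apply/VP2; case: oP2 => _ PP; rewrite mulmxA PP.
exists (P1 *m (W *m v)), (P2 *m (W *m v)); split=> //.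
have NE : N *m v = v - (P1 *m (W *m v) + P2 *m (W *m v)).
  rewrite !mulmxA -mulmxDl.
  have -> : P1 *m W + P2 *m W = 1%:M - N by rewrite NW big_bool.
  by rewrite mulmxBl mul1mx opprB addrC subrK.
rewrite -addrA -opprD -NE tVE; split; last first.
  by case: oN => _ NN; rewrite /= mulmxA NN.
(* [N v] stays in the split space: it is [v] minus vectors of the two smaller spaces, which are
   contained in it because flags increase. *)
rewrite /= NE; apply: rpredB => //; apply: rpredD.
  apply: subvP (PV1 _); apply: capvS (subvv _); apply: flag_mono.
  by rewrite lerBlDr lerDl.
by apply: subvP (PV2 _); apply: capvS; rewrite ?subvv // flag_mono // lerBlDr lerDl.
Qed.

(** The split space at [(D, D)] is all of V, and each split space is its own component plus two
    split spaces of smaller [i + j]. Phrasing the spanning as a closure principle for [W] lets it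
    prove both orthogonality and vanishing statements. *)
Lemma split_perp_span (W : set 'cV[C]_n) : W 0 ->
  (forall u v, W u -> W v -> W (u + v)) ->
  (forall i j : 'I_D.+1, tVij i j `<=` W) -> forall v, W v.
Proof.
move=> W0 WD WV v.
suff VW m (i j : nat) : (i + j < m)%N -> (i <= D)%N -> (j <= D)%N ->
    [set` Vij i j] `<=` W.
  apply: (VW (D + D).+1 D D) => //=.
  by apply/memv_capP; split; apply: flag_full.
elim: m i j => // m IHm i j; rewrite ltnS => ijm iD jD {}v /= Vv.
have [_ /(_ v Vv)[u1 [u2 [u1V u2V uV]]]] := split_perp_orthoproj i%:Z j%:Z.
have -> : v = (v - u1 - u2) + (u1 + u2) by rewrite -[v - u1 - u2]addrA -opprD subrK.
apply: (WD).
  by have := WV (inord i) (inord j); rewrite !inordK ?ltnS //; apply.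
apply: WD.
- case: i ijm iD u1V {Vv u2V uV} => [|i] ijm iD.
    by rewrite /split_space flag_Npos cap0v memv0 => /eqP->.
  rewrite (_ : i.+1%:Z - 1 = i); last by rewrite -addn1 PoszD addrK.
  by apply: IHm => //; exact: ltnW.
- case: j ijm jD u2V {Vv u1V uV} => [|j] ijm jD.
    by rewrite /split_space flag_Npos capv0 memv0 => /eqP->.
  rewrite (_ : j.+1%:Z - 1 = j); last by rewrite -addn1 PoszD addrK.
  by apply: IHm => //; [rewrite addnS in ijm|exact: ltnW].
Qed.

(** The projections [P t] on the components have no common kernel, so [common_kernel_orthoproj]
    writes 1 as the sum of the [P t W]; multiplying by [F] replaces each [P t] by a scalar multiple
    of itself. *)
Lemma acts_on_split_subalg w F : acts_on_split Es E eta mu w F -> S F.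
Proof.
move=> Fw.
have /choice[P PV] (t : 'I_D.+1 * 'I_D.+1) : exists P,
    orthoproj_on S (tVij t.1 t.2) P by case: (split_perp_orthoproj t.1 t.2).
have SP t : S (P t) by case: (PV t).
have oP t : orthoproj (P t) by case: (PV t).
have [Q [W [SQ SW oQ QP QW]]] := common_kernel_orthoproj algS SP oP.
(* Any [Q v] is killed by every [P t], hence orthogonal to every component, hence to V and to
   itself. *)
have Q0 : Q = 0.
  suff Qv (v : 'cV_n) : Q *m v = 0.
    apply/matrixP => i j.
    have := congr1 (fun N : 'cV_n => N i 0) (Qv (delta_mx j 0)).
    by rewrite -colE !mxE.
  have QQv : Q *m (Q *m v) = Q *m v by case: oQ => _ QQ; rewrite mulmxA QQ.
  apply: hdot_eq0; suff QvP u : hdot u (Q *m v) = 0 by apply: QvP.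
  move: u; apply: (@split_perp_span (fun u => hdot u (Q *m v) = 0)).
  - by rewrite hdotE mulmx0 mxE.
  - by move=> u1 u2; rewrite !hdotE => h1 h2; rewrite mulmxDr mxE h1 h2 addr0.
  - move=> i j y Vy; case: (PV (i, j)) => _ _ /(_ y)[/(_ Vy) <- _].
    rewrite hdot_orthoproj // ((QP _).1 QQv) hdotE trmx0 map_mx0 mul0mx.
    by rewrite mxE.
have FP t : F *m P t = w t.1%:Z t.2%:Z *: P t.
  apply/matrixP => i j; rewrite [LHS](_ : _ = (F *m col j (P t)) i 0).
    rewrite (Fw t.1 t.2); first by rewrite !mxE.
    case: (PV t) => _ _ /(_ (col j (P t)))[_]; apply.
    by rewrite colE mulmxA; case: (oP t) => _ ->.
  by rewrite colE mulmxA -colE [RHS]mxE.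
have -> : F = \sum_(t : 'I_D.+1 * 'I_D.+1) w t.1%:Z t.2%:Z *: P t *m W.
  rewrite -[F]mulmx1 -[1%:M]subr0 -{1}Q0 QW mulmx_sumr.
  by apply: eq_bigr => t _; rewrite mulmxA FP.
apply: (subalg_sum algS) => t _; apply: (subalgM algS) => //.
exact: (subalgZ algS).
Qed.

(** If [u F = 0], then on each component [w * (u v) = 0] with [w] nonzero, so the row [u] kills a
    spanning set. *)
Lemma acts_on_split_unit w F : (forall i j, w i j != 0) ->
  acts_on_split Es E eta mu w F -> F \in unitmx.
Proof.
move=> w0 Fw; rewrite -row_free_unit; apply: inj_row_free => u uF.
have uv (v : 'cV_n) : u *m v = 0.
  move: v; apply: (@split_perp_span [set v | u *m v = 0]) => /=.
  - by rewrite mulmx0.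
  - by move=> v1 v2; rewrite mulmxDr => -> ->; rewrite addr0.
  move=> i j v /Fw /(congr1 (mulmx u)); rewrite mulmxA uF mul0mx -scalemxAr.
  by move=> /esym/eqP; rewrite scaler_eq0 (negPf (w0 _ _)) => /eqP.
by apply/rowP => i; have := congr1 (fun N : 'M_1 => N 0 0) (uv (delta_mx i 0));
  rewrite -colE !mxE.
Qed.

End Split.

(** * Primitive idempotents *)

Section PrimitiveIdempotents.
Variables (K : fieldType) (n : nat) (M : {vspace 'M[K]_n}).
Hypothesis M1 : 1%:M \in M.
Hypothesis MM : forall F G, F \in M -> G \in M -> F *m G \in M.
Hypothesis MC : forall F G, F \in M -> G \in M -> F *m G = G *m F.

(** Induction on the rank: an idempotent that is not primitive splits as [G + H], and [G] has
    smaller rank. *)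
Lemma primitive_idempotent_below F : F \in M -> F != 0 -> F *m F = F ->
  exists2 G, primitive_idempotent M G & G *m F = G.
Proof.
have [r] := ubnP (\rank F); elim: r F => // r IHr F; rewrite ltnS => rF FM F0 FF.
have [?|nprim] := pselect (primitive_idempotent M F); first by exists F.
have [G [H [[GM HM GG HH GH] [HG FE G0 H0]]]] : exists G H,
    [/\ G \in M, H \in M, G *m G = G, H *m H = H & G *m H = 0] /\
    [/\ H *m G = 0, F = G + H, G != 0 & H != 0].
  apply: contrapT => nGH; apply: nprim; split=> // G H GM HM GG HH GH HG FE.
  have [->|G0] := eqVneq G 0; first by left.
  have [->|H0] := eqVneq H 0; first by right.
  by case: nGH; exists G, H.
have GF : G *m F = G by rewrite FE mulmxDr GG GH addr0.
have FG : F *m G = G by rewrite FE mulmxDl GG HG addr0.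
have [|P Pprim PG] := IHr G _ GM G0 GG; last first.
  by exists P => //; rewrite -PG -mulmxA GF.
(* Equal ranks would give [F = Y G], hence [F = F G = G] and [H = 0]. *)
apply: leq_trans rF; have sGF : (G <= F)%MS by rewrite -GF submxMl.
rewrite ltn_neqAle mxrankS // andbT (mxrank_leqif_eq sGF) sGF /=.
apply: contra H0 => /submxP[Y FY].
have : F *m G = F by rewrite FY -mulmxA GG.
by rewrite FG FE => /eqP; rewrite -subr_eq0 opprD addNKr oppr_eq0.
Qed.

(** By commutativity, [F = F G + (F - F G)] splits [F] into orthogonal idempotents of [M], one of
    which must vanish. *)
Lemma primitive_idempotent_absorb F G : primitive_idempotent M F ->
  G \in M -> G *m G = G -> F *m G = 0 \/ F *m G = F.
Proof.
move=> [FM _ FF Fprim] GM GG; have FG := MC FM GM.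
have FGG : F *m G *m (F *m G) = F *m G.
  by rewrite -mulmxA [G *m (_ *m _)]mulmxA -FG -!mulmxA GG mulmxA FF.
have FFG : F *m (F *m G) = F *m G by rewrite mulmxA FF.
have FGF : F *m G *m F = F *m G by rewrite -mulmxA -FG.
case: (Fprim (F *m G) (F - F *m G)); first exact: MM.
- by apply: rpredB => //; apply: MM.
- exact: FGG.
- by rewrite mulmxBl !mulmxBr FF FFG FGF FGG subrr subr0.
- by rewrite mulmxBr FGF FGG subrr.
- by rewrite mulmxBl FFG FGG subrr.
- by rewrite addrC subrK.
- by left.
- by move/eqP; rewrite subr_eq0 => /eqP <-; right.
Qed.

Lemma primitive_idempotent_orthogonal F G :
  primitive_idempotent M F -> primitive_idempotent M G -> F != G ->
  F *m G = 0.
Proof.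
move=> pF pG; apply: contraNeq => FG0.
have [FM _ FF _] := pF; have [GM _ GG _] := pG.
have [/eqP|FG] := primitive_idempotent_absorb pF GM GG; first by rewrite (negPf FG0).
have [/eqP|GF] := primitive_idempotent_absorb pG FM FF.
  by rewrite -MC // (negPf FG0).
by apply/eqP; rewrite -FG MC.
Qed.

Variables (D : nat) (E : 'I_D.+1 -> 'M[K]_n).
Hypothesis E_inj : injective E.
Hypothesis E_prim : forall F, primitive_idempotent M F <-> exists i, F = E i.

Lemma primitive_idempotent_family i : primitive_idempotent M (E i).
Proof. by apply/E_prim; exists i. Qed.

Lemma primitive_family_orthogonal i j : i != j -> E i *m E j = 0.
Proof.
move=> ij; apply: primitive_idempotent_orthogonal.
- exact: primitive_idempotent_family.
- exact: primitive_idempotent_family.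
- by apply: contra ij => /eqP /E_inj ->.
Qed.

Lemma primitive_family_mul_sum i : (\sum_j E j) *m E i = E i.
Proof.
rewrite mulmx_suml (bigD1 i) //= big1 ?addr0 => [|j ji]; last first.
  exact: primitive_family_orthogonal.
by case: (primitive_idempotent_family i).
Qed.

(** Otherwise some primitive idempotent lies below [1 - Q]; it is an [E i], but [1 - Q] annihilates
    every [E i]. *)
Lemma sum_primitive_family : \sum_i E i = 1%:M.
Proof.
set Q := \sum_i E i.
have QM : Q \in M.
  by apply: rpred_sum => i _; case: (primitive_idempotent_family i).
have QQ : Q *m Q = Q.
  by rewrite {2}/Q mulmx_sumr; apply: eq_bigr => i _;
    exact: primitive_family_mul_sum.
apply/eqP; rewrite eq_sym -subr_eq0; apply: contraT => Q1.
have [||G pG GQ] := primitive_idempotent_below _ Q1; first exact: rpredB.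
  by rewrite mulmxBl mul1mx mulmxBr mulmx1 QQ subrr subr0.
have [i GE] := (E_prim G).1 pG; have [GM G0 _ _] := pG.
case/negP: G0; rewrite -GQ MC ?rpredB // mulmxBl mul1mx GE.
by rewrite primitive_family_mul_sum subrr.
Qed.

(** Nonzero, mutually orthogonal idempotents are linearly independent, and there are already [D + 1]
    of them. *)
Lemma primitive_family_span : (\dim M <= D.+1)%N ->
  M = <<[seq E i | i : 'I_D.+1]>>%VS.
Proof.
move=> dimM; pose X := [tuple E i | i < D.+1].
have -> : [seq E i | i : 'I_D.+1] = X :> seq _ by [].
apply/esym/eqP; rewrite eqEdim; apply/andP; split.
  apply/span_subvP => _ /mapP[i _ ->].
  by case: (primitive_idempotent_family i).
suff /eqP -> : free X by rewrite size_tuple.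
have XE (i : 'I_D.+1) : X`_i = E i by rewrite -tnth_nth tnth_mktuple.
apply/freeP => k sumk0 i; have : (\sum_j k j *: X`_j) *m E i = 0.
  by rewrite sumk0 mul0mx.
rewrite mulmx_suml (bigD1 i) //= big1 ?addr0 => [|j ji].
  rewrite XE -scalemxAl.
  have [_ E0 EE _] := primitive_idempotent_family i.
  by rewrite EE => /eqP; rewrite scaler_eq0 (negPf E0) orbF => /eqP.
by rewrite XE -scalemxAl primitive_family_orthogonal // scaler0.
Qed.

End PrimitiveIdempotents.

(** The adjoint of [F] is an idempotent of [M], so [F F^t*] is 0 or [F]. The first would force
    [F = 0]; in the second [F] is visibly Hermitian. *)
Lemma primitive_idempotent_hermitian (C : numClosedFieldType) n
    (M : {vspace 'M[C]_n}) F :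
  (forall F G, F \in M -> G \in M -> F *m G \in M) ->
  (forall F G, F \in M -> G \in M -> F *m G = G *m F) ->
  (forall F, F \in M -> F^t* \in M) ->
  primitive_idempotent M F -> orthoproj F.
Proof.
move=> MM MC MT pF; have [FM F0 FF _] := pF; split=> //.
have FFt : F^t* *m F^t* = F^t* by rewrite -trmxC_mul FF.
have [FF0|FE] := primitive_idempotent_absorb MM MC pF (MT _ FM) FFt.
  by case/eqP: F0; apply: gram_eq0; rewrite -MC // MT.
by rewrite -FE trmxC_mul trmxCK.
Qed.

(* Lagrange interpolation: [F i] is the value at [H] of the polynomial
   vanishing at the [theta j], j != i, and equal to 1 at [theta i]. *)
Lemma eigenprojection_subalg (K : fieldType) n D (S : set 'M[K]_n)
    (F : 'I_D -> 'M_n) H (theta : 'I_D -> K) :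
  subalgebra S -> S H -> injective theta -> \sum_i F i = 1%:M ->
  (forall i, H *m F i = theta i *: F i) -> forall i, S (F i).
Proof.
case: n S F H => [|n] S F H algS SH theta_inj F1 HF i.
  by rewrite [F i](_ : _ = 0); [exact: subalg0 | apply/matrixP => -[]].
pose p := \prod_(j | j != i) ('X - (theta j)%:P).
have pF j : horner_mx H p *m F j = p.[theta j] *: F j.
  elim/poly_ind: p => [|p c IHp]; first by rewrite rmorph0 mul0mx horner0 scale0r.
  rewrite mulrC rmorphD rmorphM /= horner_mx_X horner_mx_C mulmxDl.
  rewrite !hornerE -[H * _]/(H *m _).
  rewrite -[H *m _ *m _]mulmxA IHp -scalemxAr HF scalerA mul_scalar_mx.
  by rewrite -scalerDl mulrC.
have pi0 : p.[theta i] != 0.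
  rewrite /p horner_prod prodf_seq_neq0; apply/allP => j _; apply/implyP => ji.
  rewrite hornerXsubC subr_eq0; by apply: contra ji => /eqP /theta_inj ->.
have pj0 j : j != i -> p.[theta j] = 0.
  by move=> ji; rewrite /p horner_prod (bigD1 j) //= hornerXsubC subrr mul0r.
rewrite -[F i]scale1r -(mulVf pi0) -scalerA -pF.
apply: (subalgZ algS).
(* [p(H)] annihilates every other [F j], and the [F j] sum to 1. *)
have -> : horner_mx H p *m F i = horner_mx H p.
  rewrite -[RHS]mulmx1 -F1 mulmx_sumr (bigD1 i) //= big1 ?addr0 // => j ji.
  by rewrite pF pj0 // scale0r.
exact: subalg_horner.
Qed.

(** * Bose-Mesner algebras *)

Section GraphDistance.
Variables (X : finType) (e : rel X).

Lemma gdist_le_path y w : path e y w -> (gdist e y (last y w) <= size w)%N.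
Proof.
move=> yw; rewrite leqNgt; apply/negP => lt_w.
(* [gdist] never exceeds its default value [#|X|], so a walk shorter than [gdist] has a length
   within the searched range. *)
have wX : (size w < #|X|)%N.
  by rewrite -[#|X|](size_iota 0); apply: leq_trans lt_w (find_size _ _).
have /negP[] := negbT (before_find 0%N lt_w).
by rewrite nth_iota // add0n; apply/existsP; exists (in_tuple w); rewrite /= yw /=.
Qed.

Hypothesis e_conn : graph_connected e.

(** A walk without repeated vertices has fewer than [#|X|] steps, so in a connected graph the search
    defining [gdist] succeeds. *)
Lemma gdist_path y z :
  exists2 w, path e y w & last y w = z /\ size w = gdist e y z.
Proof.
have /connectP[w0 yw0 ->] := e_conn y z.
have [w yw uw _] := shortenP yw0.
rewrite /gdist; set a := (X in find X _).
have wX : (size w < #|X|)%N.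
  by have := max_card (mem (y :: w)); rewrite (card_uniqP uw).
have : has a (iota 0 #|X|).
  apply/hasP; exists (size w); first by rewrite mem_iota.
  by apply/existsP; exists (in_tuple w); rewrite /= yw /=.
move=> ha; have /existsP[t /andP[yt /eqP lt]] := nth_find 0%N ha.
exists t => //; split=> //; rewrite size_tuple nth_iota //.
by move: ha; rewrite has_find size_iota.
Qed.

Lemma gdist_eq0 y z : (gdist e y z == 0%N) = (y == z).
Proof.
apply/eqP/eqP => [d0|<-]; last by apply/eqP; rewrite -leqn0 (@gdist_le_path y [::]).
by have [[|? ?] _ []] := gdist_path y z; rewrite d0.
Qed.

Lemma gdist_sym y z : symmetric e -> gdist e y z = gdist e z y.
Proof.
move=> e_sym; wlog suff H : y z / (gdist e y z <= gdist e z y)%N.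
  by apply/eqP; rewrite eqn_leq !H.
have [w zw [<- <-]] := gdist_path z y.
have := @gdist_le_path (last z w) (rev (belast z w)).
rewrite size_rev size_belast rev_path.
rewrite (eq_path (e' := e)) => [/(_ zw)|? ?]; last first.
  exact: e_sym.
by case: w {zw} => //= u w; rewrite rev_cons last_rcons.
Qed.

(** [w] is the first vertex after [y] on a shortest walk: the rest of the walk bounds its distance
    to [z] from above, and prepending [y] bounds it from below. *)
Lemma gdist_step k y z : gdist e y z = k.+1 ->
  exists w, [/\ e y w, gdist e y w = 1%N & gdist e w z = k].
Proof.
move=> dyz; have [[|w s]] := gdist_path y z; first by rewrite dyz => _ [].
rewrite /= dyz => /andP[yw ws] [lz [sk]].
have dwz : gdist e w z = k.
  apply/eqP; rewrite eqn_leq -{1}sk -lz gdist_le_path //= lz.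
  have [t wt [lt st]] := gdist_path w z.
  by rewrite -st -ltnS -dyz -lt (@gdist_le_path y (w :: t)) //= yw.
exists w; split=> //; apply/eqP; rewrite eqn_leq (@gdist_le_path y [:: w]) /= ?yw //.
rewrite lt0n gdist_eq0; apply: contra_eqN dwz => /eqP <-.
by rewrite dyz gtn_eqF.
Qed.

Lemma gdist_le_diameter y z : (gdist e y z <= diameter e)%N.
Proof.
apply: leq_trans (leq_bigmax y).
exact: (leq_bigmax (F := gdist e y) z).
Qed.

(** Start from a pair realizing the diameter, which exists because [y] makes X nonempty, and remove
    first steps of shortest walks. *)
Lemma gdist_surj k (y : X) : (k <= diameter e)%N ->
  exists z1 z2, gdist e z1 z2 = k.
Proof.
move=> kD; have [z1 [z2 dE]] : exists z1 z2, gdist e z1 z2 = diameter e.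
  have X0 : (0 < #|X|)%N by apply/card_gt0P; exists y.
  have [z1 E1] := bigop.eq_bigmax (fun z1 => \max_z gdist e z1 z) X0.
  have [z2 E2] := bigop.eq_bigmax (gdist e z1) X0.
  by exists z1, z2; rewrite /diameter E1 E2.
elim: (diameter e - k)%N {-2}k (erefl (diameter e - k)%N) kD => [|m IHm] j.
  move=> /eqP; rewrite subn_eq0 => Dj jD; exists z1, z2.
  by rewrite dE; apply/eqP; rewrite eqn_leq Dj.
move=> mE jD; have jltD : (j < diameter e)%N by rewrite -subn_gt0 mE.
have [||y1 [y2 /gdist_step[w [_ _ dw]]]] := IHm j.+1; first by rewrite subnS mE.
  exact: jltD.
by exists w, y2.
Qed.

(** Combined with the formula for [c_k], this excludes [b^k = 1] and so keeps the eigenvalues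
    distinct. *)
Lemma cnum_neq0 p k (y : X) : distance_regular e p ->
  (0 < k)%N -> (k <= diameter e)%N -> cnum p k != 0%N.
Proof.
move=> e_dr; case: k => // k _ kD; have [z1 [z2 dz]] := gdist_surj y kD.
have [w [_ d1 dk]] := gdist_step dz.
rewrite /= -(e_dr _ _ _ _ _ dz) -lt0n; apply/card_gt0P; exists w.
by rewrite inE d1 dk !eqxx.
Qed.

End GraphDistance.

Lemma memv_span_image (K : fieldType) (V : vectType K) m (F : 'I_m -> V) v :
  v \in <<[seq F i | i : 'I_m]>>%VS -> exists c, v = \sum_i c i *: F i.
Proof.
rewrite (_ : [seq F i | i : 'I_m] = [tuple F i | i < m] :> seq _) //.
move=> /coord_span ->; exists (fun i => coord [tuple F i | i < m] i v).
by apply: eq_bigr => i _; rewrite -tnth_nth tnth_mktuple.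
Qed.

(** * The Bose-Mesner algebra and the dual idempotents *)

Section BoseMesner.
Variables (C : numClosedFieldType) (X : finType) (e : rel X).
Hypotheses (e_sym : symmetric e) (e_conn : graph_connected e).
Variable p : nat -> nat -> nat -> nat.
Hypothesis e_dr : distance_regular e p.
Local Notation D := (diameter e).
Local Notation M := (bose_mesner C e D).

Lemma dist_mx_mem (i : nat) : (i <= D)%N -> dist_mx C e i \in M.
Proof.
move=> iD; apply: memv_span; apply/mapP; exists (inord i).
  by rewrite mem_enum.
by rewrite inordK.
Qed.

Lemma dist_mx0 : dist_mx C e 0 = 1%:M.
Proof.
apply/matrixP => s t; rewrite !mxE gdist_eq0 //.
by rewrite (inj_eq enum_val_inj).
Qed.

Lemma bose_mesner1 : 1%:M \in M.
Proof. by rewrite -dist_mx0 dist_mx_mem. Qed.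

Lemma dist_mx_mul i j :
  dist_mx C e i *m dist_mx C e j =
  \sum_(h < D.+1) (p h i j)%:R *: dist_mx C e h.
Proof.
apply/matrixP => s t; rewrite mxE summxE.
set y := enum_val s; set z := enum_val t.
have dD : (gdist e y z < D.+1)%N by rewrite ltnS gdist_le_diameter.
rewrite [RHS](bigD1 (Ordinal dD)) //= [X in _ + X]big1 => [|h hd]; last first.
  rewrite !mxE (_ : (_ == _) = false) ?mulr0 //.
  by apply: contraNF hd => /eqP hE; apply/eqP/val_inj.
rewrite addr0 !mxE eqxx mulr1 -(e_dr i j (erefl (gdist e y z))).
rewrite -[X in _ = X%:R]sum1_card natr_sum.
rewrite [RHS](reindex _ (onW_bij _ (@enum_val_bij X))) /=.
rewrite [RHS]big_mkcond; apply: eq_bigr => k _; rewrite !mxE inE.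
by rewrite -natrM mulnb; case: ifP.
Qed.

Lemma bose_mesnerM F G : F \in M -> G \in M -> F *m G \in M.
Proof.
move=> /memv_span_image[c ->] /memv_span_image[d ->].
rewrite mulmx_suml; apply: rpred_sum => i _.
rewrite mulmx_sumr; apply: rpred_sum => j _.
rewrite -scalemxAl -scalemxAr; do 2!apply: rpredZ.
rewrite dist_mx_mul; apply: rpred_sum => h _; apply: rpredZ.
by apply: dist_mx_mem; rewrite -ltnS.
Qed.

Lemma dist_mx_tr i : (dist_mx C e i)^T = dist_mx C e i.
Proof. by apply/matrixP => s t; rewrite !mxE gdist_sym. Qed.

Lemma bose_mesner_tr F : F \in M -> F^T = F.
Proof.
move=> /memv_span_image[c ->]; rewrite raddf_sum; apply: eq_bigr => i _ /=.
by rewrite linearZ /= dist_mx_tr.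
Qed.

(** All elements are symmetric, products included, so [F G = (F G)^T = G F]. *)
Lemma bose_mesnerC F G : F \in M -> G \in M -> F *m G = G *m F.
Proof.
move=> FM GM; rewrite -[LHS](bose_mesner_tr (bose_mesnerM FM GM)) trmx_mul.
by rewrite !bose_mesner_tr.
Qed.

Lemma bose_mesner_conj F : F \in M -> F^t* \in M.
Proof.
move=> FM; rewrite bose_mesner_tr //; have [c ->] := memv_span_image FM.
rewrite map_mx_sum; apply: rpred_sum => i _; rewrite map_mxZ; apply: rpredZ.
rewrite (_ : map_mx _ _ = dist_mx C e i); first by apply: dist_mx_mem; rewrite -ltnS.
by apply/matrixP => s t; rewrite !mxE rmorph_nat.
Qed.

Lemma dim_bose_mesner : (\dim M <= D.+1)%N.
Proof. by apply: leq_trans (dim_span _) _; rewrite size_map -cardE card_ord. Qed.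

Variable x : X.
Local Notation Es := (@dual_idem C X e D x).

Lemma dual_idem_orthoproj i : orthoproj (Es i).
Proof.
split.
  rewrite /dual_idem tr_diag_mx map_diag_mx; congr diag_mx.
  by apply/rowP => s; rewrite !mxE rmorph_nat.
rewrite /dual_idem mulmx_diag; congr diag_mx.
by apply/rowP => s; rewrite !mxE -natrM mulnb andbb.
Qed.

Lemma dual_idem_orthogonal i j : i != j -> Es i *m Es j = 0.
Proof.
move=> ij; rewrite /dual_idem mulmx_diag; apply/matrixP => s t.
rewrite !mxE -natrM mulnb (_ : _ && _ = false) ?mul0rn //.
by apply: contraNF ij => /andP[/eqP-> /eqP/val_inj->].
Qed.

Lemma sum_dual_idem : \sum_i Es i = 1%:M.
Proof.
apply/matrixP => s t; rewrite summxE.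
have dD : (gdist e x (enum_val s) < D.+1)%N by rewrite ltnS gdist_le_diameter.
rewrite (bigD1 (Ordinal dD)) //= big1 => [|h hd]; last first.
  rewrite !mxE (_ : (_ == _) = false) ?mul0rn //.
  by apply: contraNF hd => /eqP hE; apply/eqP/val_inj.
by rewrite !mxE eqxx addr0.
Qed.

End BoseMesner.

(** * The q-tetrahedron algebra *)

Lemma subalg_presented (K : fieldType) (I : Type)
    (rel : alg_expr K I -> alg_expr K I -> Prop) n (S : set 'M[K]_n)
    (f : {rmorphism presented rel -> 'M[K]_n}) :
  subalgebra S -> scalable f -> (forall i, S (f (presented_gen rel i))) ->
  range f `<=` S.
Proof.
move=> algS fZ Sgen _ [g _ <-]; elim/presented_ind: g => u.
elim: u => [i|a|u IHu v IHv|u IHu v IHv].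
- exact: Sgen.
- by rewrite presented_piZ fZ rmorph1; apply: (subalgZ algS); exact: subalg1.
- by rewrite presented_piD rmorphD; exact: (subalgD algS).
- by rewrite presented_piM rmorphM; exact: (subalgM algS).
Qed.

Lemma Z4_cases (i : 'Z_4) : [\/ i = 0, i = 1, i = 2 | i = 3].
Proof.
case: i => [[|[|[|[|//]]]] lti].
- by apply: Or41; apply: val_inj.
- by apply: Or42; apply: val_inj.
- by apply: Or43; apply: val_inj.
- by apply: Or44; apply: val_inj.
Qed.

Section QtetrahedronMatrices.
Variables (K : fieldType) (q : K) (n : nat) (f : {rmorphism qtet q -> 'M[K]_n}).
Hypothesis f_lin : scalable f.

Lemma qtet_inv_mulmx i j (ij : Defs.arc i j) (ji : Defs.arc j i) : j - i = 2 ->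
  f (qtet_x q i j ij) *m f (qtet_x q j i ji) = 1%:M.
Proof.
move=> ji2; have := (presented_piP _ _ _).2
  (cong_rel (qtet_inv (K := K) q ij ji ji2)).
rewrite presented_piM presented_piZ scale1r => /(congr1 f).
by rewrite rmorphM rmorph1.
Qed.

(** This handles [x20] and [x31], whose matrices are determined only as inverses of those of [x02]
    and [x13]. *)
Lemma subalg_qtet_inv (S : set 'M[K]_n) i j (ij : Defs.arc i j) (ji : Defs.arc j i) :
  subalgebra S -> j - i = 2 ->
  S (f (qtet_x q i j ij)) -> S (f (qtet_x q j i ji)).
Proof.
move=> algS ji2 Sij; have fij := qtet_inv_mulmx ij ji ji2.
have [u _] := mulmx1_unit fij.
by rewrite -[f _](mulKmx u) fij mulmx1; exact: subalg_invmx.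
Qed.

(* For [q = 0] (where [q^-1 = 0] as well), the q-Weyl relations read [0 = 1]. *)
Lemma qtet_rep_q_neq0 : (0 < n)%N -> q != 0.
Proof.
move=> n0; apply/eqP => q0.
have w : (1 - 0 : 'Z_4, 2 - 1 : 'Z_4) \in [:: (1, 1); (1, 2); (2, 1)] by [].
have := (presented_piP _ _ _).2
  (cong_rel (@qtet_weyl K q 0 1 2 isT isT w)).
rewrite presented_piM !presented_piZ -presented_scaleAl => /(congr1 f).
have qq0 : (q - q^-1)^-1 = 0 by rewrite q0 invr0 subrr invr0.
rewrite !f_lin rmorph1 scale1r qq0 scale0r.
move=> /(congr1 (fun N : 'M_n => N (Ordinal n0) (Ordinal n0))).
by rewrite !mxE eqxx mul1r => /eqP; rewrite eq_sym oner_eq0.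
Qed.

End QtetrahedronMatrices.

(** For [i < j], the powers of [q] at [i] and [j] have ratio [q^(2(j-i))], so equal values would
    make [q^2] a root of unity of order at most [D]. *)
Lemma expfz_affine_inj (K : fieldType) (q a0 a1 : K) D :
  q != 0 -> a1 != 0 ->
  (forall k, (0 < k)%N -> (k <= D)%N -> (q ^+ 2) ^+ k != 1) ->
  injective (fun i : 'I_D.+1 => a0 + a1 * q ^ (D%:Z - 2 * i%:Z)).
Proof.
move=> q0 a10 q1; suff lt_neq (i j : 'I_D.+1) : (i < j)%N ->
    a0 + a1 * q ^ (D%:Z - 2 * i%:Z) <> a0 + a1 * q ^ (D%:Z - 2 * j%:Z).
  move=> i j Eij; have [ij|ji|] := ltngtP i j; last exact: val_inj.
    by case: (lt_neq _ _ ij).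
  by case: (lt_neq _ _ ji).
move=> ij /addrI /(mulfI a10) Eq.
have /eqP[] := q1 (j - i)%N ltac:(by rewrite subn_gt0)
  ltac:(by apply: leq_trans (leq_subr _ _) _; rewrite -ltnS).
rewrite -exprM exprnP.
have -> : ((2 * (j - i))%N)%:Z = (D%:Z - 2 * i%:Z) - (D%:Z - 2 * j%:Z).
  by rewrite PoszM -subzn ?(ltnW ij) // mulrBr; lia.
by rewrite expfzDr // -invr_expz Eq divff // expfz_neq0.
Qed.

(* The Terwilliger algebra and the image of the q-tetrahedron algebra *)
Local Close Scope sesquilinear_scope.

Theorem theorem12p2 (R : realType)
  (X : finType) (e : rel X)
  (e_sym : symmetric e) (e_irr : irreflexive e) (e_conn : graph_connected e)
  (D : nat) (D_diam : D = diameter e) (D_ge3 : (3 <= D)%N)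
  (p : nat -> nat -> nat -> nat) (e_dr : distance_regular e p)
  (b beta q : R[i]) (b_neq1 : b != 1)
  (c_eq : forall i : nat, (i <= D)%N ->
    (cnum p i)%:R = b ^ (i%:Z - 1) * ((b ^+ i - 1) / (b - 1)))
  (b_eq : forall i : nat, (i <= D)%N ->
    (bnum p i)%:R = (beta + 1 - b ^+ i) * ((b ^+ D - b ^+ i) / (b - 1)))
  (q_b : b = q ^+ 2)
  (E : 'I_D.+1 -> 'M[R[i]]_#|X|) (E_prim : is_primitive_idempotents e E)
  (kr : 'I_D.+1 -> 'I_D.+1 -> 'I_D.+1 -> R[i]) (E_krein : is_krein E kr)
  (kr_p : forall h i j : 'I_D.+1, kr h i j = (p h i j)%:R)
  (x : X) (Es : 'I_D.+1 -> 'M[R[i]]_#|X|)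
  (Es_def : forall i, Es i = dual_idem R[i] e x i)
  (A1 A1s : 'M[R[i]]_#|X|)
  (A1_def : A1 = dist_mx R[i] e 1) (A1s_def : A1s = dual_adjacency x E)
  (theta thetas : 'I_D.+1 -> R[i])
  (A1_eig : forall i, A1 *m E i = theta i *: E i)
  (A1s_eig : forall i, A1s *m Es i = thetas i *: Es i)
  (alpha0 alpha1 : R[i]) (alpha1_neq0 : alpha1 != 0)
  (theta_eq : forall i : 'I_D.+1,
    theta i = alpha0 + alpha1 * q ^ (D%:Z - 2 * i%:Z))
  (thetas_eq : forall i : 'I_D.+1, thetas i = theta i)
  (A As : 'M[R[i]]_#|X|)
  (A_def : A1 = alpha0%:M + alpha1 *: A)
  (As_def : A1s = alpha0%:M + alpha1 *: As)
  (B Bs K Ks Phi Psi : 'M[R[i]]_#|X|)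
  (B_act : acts_on_split Es E Down Up (fun i j => q ^ (i - j)) B)
  (Bs_act : acts_on_split Es E Up Down (fun i j => q ^ (j - i)) Bs)
  (K_act : acts_on_split Es E Down Down (fun i j => q ^ (i - j)) K)
  (Ks_act : acts_on_split Es E Up Up (fun i j => q ^ (i - j)) Ks)
  (Phi_act : acts_on_split Es E Down Down (fun i j => q ^ (i + j - D%:Z)) Phi)
  (Psi_act : acts_on_split Es E Down Up (fun i j => q ^ (i + j - D%:Z)) Psi)
  (vartheta : {rmorphism qtet q -> 'M[R[i]]_#|X|})
  (vartheta_lin : scalable vartheta)
  (x01 : vartheta (qtet_x q 0 1 isT) = A *m Phi *m invmx Psi)
  (x12 : vartheta (qtet_x q 1 2 isT) = B *m invmx Phi)
  (x23 : vartheta (qtet_x q 2 3 isT) = As *m Phi *m Psi)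
  (x30 : vartheta (qtet_x q 3 0 isT) = Bs *m invmx Phi)
  (x02 : vartheta (qtet_x q 0 2 isT) = K *m invmx Psi)
  (x13 : vartheta (qtet_x q 1 3 isT) = Ks *m Psi) :
  (range vartheta `<=` terwilliger R[i] e D x) /\
  terwilliger R[i] e D x = generated_algebra (range vartheta `|` [set Phi; Psi]).
Proof.
subst D; have {Es_def} EsE : Es = @dual_idem R[i] X e (diameter e) x by apply/funext.
subst Es; set T := terwilliger _ _ _ _; pose D := diameter e.
have algT : subalgebra T by apply: generated_subalgebra.
have X0 : (0 < #|X|)%N by apply/card_gt0P; exists x.
(* Nonvanishing of [q] follows from the existence of a representation on the nonzero space V. *)
have q0 : q != 0 := qtet_rep_q_neq0 vartheta_lin X0.
have theta_inj : injective theta.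
  have E_theta : theta = fun i => alpha0 + alpha1 * q ^ (D%:Z - 2 * i%:Z).
    by apply/funext => i; rewrite theta_eq.
  rewrite E_theta; apply: expfz_affine_inj => // k k0 kD.
  (* If [b^k = 1], the factor [b^k - 1] in the formula for [c_k] vanishes. *)
  apply: contra_neq (cnum_neq0 e_conn x e_dr k0 kD) => qk1.
  by apply/eqP; rewrite -(pnatr_eq0 R[i]) c_eq // q_b qk1 subrr mul0r mulr0.
have MM := bose_mesnerM (C := R[i]) e_dr.
have MC := bose_mesnerC (C := R[i]) e_sym e_conn e_dr.
have [E_inj E_P] := E_prim.
have pE := primitive_idempotent_family E_P.
have sumE := sum_primitive_family (bose_mesner1 _ e_conn) MM MC E_inj E_P.
have sumEs := sum_dual_idem R[i] e x.
have ME := primitive_family_span MM MC E_inj E_P (dim_bose_mesner _ _).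
have A1M : A1 \in bose_mesner R[i] e D.
  by rewrite A1_def; apply: dist_mx_mem; exact: leq_trans D_ge3.
have MT F : F \in bose_mesner R[i] e D -> T F.
  by move=> FM; apply: sub_gen_smallest; left.
have TEs (i : 'I_D.+1) : T (dual_idem R[i] e x i).
  apply: sub_gen_smallest; right; apply: memv_span.
  by apply/mapP; exists i; rewrite ?mem_enum.
have resE : resolution T E.
  split=> // [i|i|]; first by apply: MT; case: (pE i).
    apply: (primitive_idempotent_hermitian MM MC) (pE i).
    exact: bose_mesner_conj.
  exact: (primitive_family_orthogonal MM MC E_inj E_P).
have resEs : resolution T (@dual_idem R[i] X e D x).
  split=> // [i|]; [exact: dual_idem_orthoproj | exact: dual_idem_orthogonal].
have TA : T A.
  rewrite -[A](scalerK alpha1_neq0) -[_ *: A](addKr alpha0%:M) -A_def.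
  apply: (subalgZ algT); apply: (subalgD algT); last exact: MT.
  by rewrite -scalemx1 -scaleNr scalemx1; exact: subalg_scalar.
have TAs : T As.
  rewrite -[As](scalerK alpha1_neq0) -[_ *: As](addKr alpha0%:M) -As_def.
  apply: (subalgZ algT); apply: (subalgD algT).
    by rewrite -scalemx1 -scaleNr scalemx1; exact: subalg_scalar.
  (* Multiplying by 1 as the sum of the dual idempotents turns [A1s] into a linear combination of
     them, by its eigenvalue equations. *)
  rewrite -[A1s]mulmx1 -sumEs mulmx_sumr; apply: (subalg_sum algT) => i _.
  by rewrite A1s_eig; exact: (subalgZ algT).
have actT := acts_on_split_subalg algT resEs resE.
have actU := acts_on_split_unit algT resEs resE.
have TPhi := actT _ _ _ _ Phi_act; have TPsi := actT _ _ _ _ Psi_act.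
have uPhi : Phi \in unitmx.
  by apply: (actU _ _ _ _ _ Phi_act) => i j; rewrite expfz_neq0.
have uPsi : Psi \in unitmx.
  by apply: (actU _ _ _ _ _ Psi_act) => i j; rewrite expfz_neq0.
have TiPhi := subalg_invmx algT TPhi.
have TiPsi := subalg_invmx algT TPsi.
have TM := subalgM algT.
have T02 : T (vartheta (qtet_x q 0 2 isT)).
  by rewrite x02; apply: (TM) => //; exact: (actT _ _ _ _ K_act).
have T13 : T (vartheta (qtet_x q 1 3 isT)).
  by rewrite x13; apply: (TM) => //; exact: (actT _ _ _ _ Ks_act).
have Tgen i j (a : Defs.arc i j) : T (vartheta (qtet_x q i j a)).
  (* Of the sixteen pairs, eight are arcs; [x02] and [x13] are closed at once by [T02] and [T13],
     leaving six. *)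
  move: a; have [] := Z4_cases i => ->; have [] := Z4_cases j => -> a; try by [];
    rewrite (bool_irrelevance a isT) //.
  - by rewrite x01; exact: (TM _ _ (TM _ _ TA TPhi) TiPsi).
  - by rewrite x12; apply: (TM) => //; exact: (actT _ _ _ _ B_act).
  - by apply: (subalg_qtet_inv (isT : Defs.arc 2 0) algT _ T02); apply/eqP.
  - by rewrite x23; exact: (TM _ _ (TM _ _ TAs TPhi) TPsi).
  - by rewrite x30; apply: (TM) => //; exact: (actT _ _ _ _ Bs_act).
  - by apply: (subalg_qtet_inv (isT : Defs.arc 3 1) algT _ T13); apply/eqP.
have rangeT : range vartheta `<=` T.
  by apply: subalg_presented => // -[[i j] a]; exact: Tgen.
split=> //; apply/seteqP; split; last first.
  by apply: smallest_sub => // F [/rangeT|[->|->]].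
set G := generated_algebra _.
have algG : subalgebra G by exact: generated_subalgebra.
have GM := subalgM algG.
have Gr g : G (vartheta g) by apply: sub_gen_smallest; left; exists g.
have GPhi : G Phi by apply: sub_gen_smallest; right; left.
have GPsi : G Psi by apply: sub_gen_smallest; right; right.
have GiPhi := subalg_invmx algG GPhi.
have GiPsi := subalg_invmx algG GPsi.
have GA : G A.
  have -> : A = vartheta (qtet_x q 0 1 isT) *m Psi *m invmx Phi.
    by rewrite x01 mulmxKV // mulmxK.
  exact: (GM _ _ (GM _ _ (Gr _) GPsi) GiPhi).
have GAs : G As.
  have -> : As = vartheta (qtet_x q 2 3 isT) *m invmx Psi *m invmx Phi.
    by rewrite x23 !mulmxK.
  exact: (GM _ _ (GM _ _ (Gr _) GiPsi) GiPhi).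
have GA1 : G A1.
  by rewrite A_def; apply: (subalgD algG);
    [exact: subalg_scalar | exact: (subalgZ algG)].
have GA1s : G A1s.
  by rewrite As_def; apply: (subalgD algG);
    [exact: subalg_scalar | exact: (subalgZ algG)].
have GE := eigenprojection_subalg algG GA1 theta_inj sumE A1_eig.
have GEs : forall i : 'I_D.+1, G (dual_idem R[i] e x i).
  apply: (eigenprojection_subalg algG GA1s _ sumEs A1s_eig).
  by move=> i j; rewrite !thetas_eq => /theta_inj.
(* The dual algebra is by definition spanned by the dual idempotents, while the Bose-Mesner algebra
   is defined by distance matrices and must first be rewritten as the span of the [E i]. *)
apply: smallest_sub => // F [] /=; last exact: subalg_span.
by rewrite ME; exact: subalg_span.
Qed.
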